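(* Let $F$ be a graph which is either a cycle or a balanced, complete, multipartite graph with at least two edges. Then for every forest of copies $\mathscr{F}$ of $F$ there exists an integer $r\geq 2$ such that every graph $G$ with $G\xrightarrow{\text{n.n.i.}}(F)_r$ contains a subgraph isomorphic to $\bigcup\mathscr{F}$.
   Context: A set of graphs $\mathscr{F}$ is a forest of copies if there is an enumeration $\mathscr{F}=\{F_1,\dots,F_{|\mathscr{F}|}\}$ such that for every $j\in[2,|\mathscr{F}|]$ the set $V(F_j)\cap\bigcup_{i<j}V(F_i)$ is either empty, or a single vertex, or an edge belonging both to $E(F_j)$ and to $\bigcup_{i<j}E(F_i)$. A forest of copies of $F$ is such a set in which every member is isomorphic to $F$; $\bigcup\mathscr{F}$ denotes the graph with vertex set $\bigcup_i V(F_i)$ and edge set $\bigcup_i E(F_i)$. For graphs $F,G$ and $r\ge 2$, $G\xrightarrow{\text{n.n.i.}}(F)_r$ means that every colouring of $E(G)$ with $r$ colours yields a monochromatic (not necessarily induced) subgraph of $G$ isomorphic to $F$. *)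

(* Defs.v *)
From HB Require Import structures.
From mathcomp Require Import all_boot.

Set Implicit Arguments.
Unset Strict Implicit.
Unset Printing Implicit Defensive.

Definition graph_axiom (T : finType) (VE : {set T} * {set {set T}}) : bool :=
  [forall e in VE.2, (e \subset VE.1) && (#|e| == 2)].

(* Finite simple graphs whose vertices are drawn from an ambient finite type;
   the vertex set is explicit, so that graphs over the same ambient type can
   overlap. *)
Record graph (T : finType) := Graph {
  graph_val :> {set T} * {set {set T}};
  _ : graph_axiom graph_val }.

HB.instance Definition _ (T : finType) := [isSub for @graph_val T].
HB.instance Definition _ (T : finType) := [Finite of graph T by <:].

Definition vertices (T : finType) (G : graph T) : {set T} := (graph_val G).1.
Definition edges (T : finType) (G : graph T) : {set {set T}} := (graph_val G).2.

Definition subgraph (T : finType) (H G : graph T) : Prop :=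
  vertices H \subset vertices G /\ edges H \subset edges G.

Definition isomorphic (S T : finType) (G : graph S) (H : graph T) : Prop :=
  exists f : {x | x \in vertices G} -> {y | y \in vertices H},
    bijective f /\
    forall x y : {x | x \in vertices G},
      ([set val x; val y] \in edges G)
        = ([set val (f x); val (f y)] \in edges H).

Definition has_subgraph_isomorphic_to (S T : finType)
    (G : graph T) (F : graph S) : Prop :=
  exists H : graph T, subgraph H G /\ isomorphic H F.

Lemma graph_union_subproof (T : finType) (FF : {set graph T}) :
  graph_axiom (\bigcup_(H in FF) vertices H, \bigcup_(H in FF) edges H).
Proof.
apply/forall_inP => e /= /bigcupP[H HFF eH].
have /forall_inP/(_ _ eH)/andP[eV ->] : graph_axiom (graph_val H).
  by case: {HFF eH} H.
by rewrite andbT (subset_trans eV) // (bigcup_sup H).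
Qed.

Definition graph_union (T : finType) (FF : {set graph T}) : graph T :=
  Graph (graph_union_subproof FF).

Definition is_cycle (T : finType) (F : graph T) : Prop :=
  exists s : seq T,
    [/\ 3 <= size s, uniq s, vertices F = [set x in s]
      & edges F = [set [set x; next s x] | x in s]].

(* P is the set of vertex classes; balanced means that they all have the same
   size (sizes differing by one are not allowed). *)
Definition is_balanced_complete_multipartite (T : finType) (F : graph T) :
    Prop :=
  exists P : {set {set T}},
    [/\ partition P (vertices F),
        {in P &, forall A B : {set T}, #|A| = #|B|}
      & edges F = [set [set x; y] | x in vertices F, y in vertices F
                                  & pblock P x != pblock P y]].

(* Enumerations start at index 0, so the first graph is f 0 and the condition
   is imposed on the indices 0 < j. *)
Definition forest_of_copies (T : finType) (FF : {set graph T}) : Prop :=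
  exists f : 'I_#|FF| -> graph T,
    [/\ injective f, FF = [set f j | j : 'I_#|FF|]
      & forall j : 'I_#|FF|, 0 < j ->
          let A := vertices (f j)
                     :&: \bigcup_(i : 'I_#|FF| | i < j) vertices (f i) in
          [\/ A = set0,
              exists x : T, A = [set x]
            | A \in edges (f j) /\
              A \in \bigcup_(i : 'I_#|FF| | i < j) edges (f i)]].

Definition forest_of_copies_of (S T : finType) (F : graph S)
    (FF : {set graph T}) : Prop :=
  forest_of_copies FF /\ forall H : graph T, H \in FF -> isomorphic H F.

Definition arrows_nni (S T : finType) (G : graph T) (F : graph S) (r : nat) :
    Prop :=
  forall c : {e | e \in edges G} -> 'I_r,
    exists H : graph T,
      [/\ subgraph H G, isomorphic H F
        & exists k : 'I_r,
            forall e : {e | e \in edges G}, val e \in edges H -> c e = k].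

(* Main.v *)
Require Import Defs.
From mathcomp Require Import all_boot perm zify.
From Stdlib Require Import Classical.

(** Call an edge e of a set E of edges rich if, for every set W of boundedly
    many vertices, some copy of F with edges in E contains e and meets W at most
    in e.  The claim reduces to: if every colouring of E with sufficiently many
    colours yields a monochromatic copy of F, then E has a rich edge.  Applied
    to the non-rich edges of E, it shows that the rich ones still have the
    Ramsey property; iterating gives a chain of edge sets, each rich in the
    preceding one, along which the forest of copies is embedded copy by copy.
    Here arc-transitivity and minimum degree 2 of F let one attach a new copy at
    a prescribed edge, at a prescribed vertex, or nowhere.

    To find a rich edge, colour E so that in every monochromatic copy each edge
    uv lies in a kernel K spanning no further edge of the copy, such that the
    copy can be moved off any small set of vertices while K stays fixed.  For
    complete multipartite graphs K = {u, v}, since any third vertex is adjacent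
    to u or v.  For cycles of length n one repeats the step n - 1 times: every
    cycle in the new colour class has kernels inside the old one, and rerouting
    a segment of the cycle shortens the arc spanned by the kernel by one until
    only the edge itself is left. *)

Set Implicit Arguments.
Unset Strict Implicit.
Unset Printing Implicit Defensive.

(** * Colouring digraphs of bounded out-degree *)

(** In-degrees and out-degrees have equal sums on every vertex subset, so some vertex has at most
    [d + d] neighbours there; delete it and colour greedily. *)
Lemma bounded_out_degree_colouring (X : finType) (d : nat) (D : X -> {set X}) :
  (forall x, #|D x| <= d) ->
  exists c : X -> 'I_(d + d).+1, forall x y, y \in D x -> y != x -> c x != c y.
Proof.
move=> Dd.
suff H n (A : {set X}) : #|A| = n ->
    exists c : X -> 'I_(d + d).+1,
      forall x y, x \in A -> y \in A -> y \in D x -> y != x -> c x != c y.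
  by have [c cP] := H _ [set: X] erefl; exists c => x y; apply: cP; rewrite inE.
elim: n A => [|n IHn] A cA.
  by exists (fun=> ord0) => x y; rewrite (cards0_eq cA) inE.
pose inN x := [set y in A | x \in D y].
have [x xA xd] : exists2 x, x \in A & #|inN x| <= d.
  apply: NNPP => noX.
  have: \sum_(x in A) #|inN x| >= \sum_(x in A) d.+1.
    by apply: leq_sum => x xA; rewrite ltnNge; apply/negP => xd; apply: noX; exists x.
  have ->: \sum_(x in A) #|inN x| = \sum_(y in A) #|D y :&: A|.
    transitivity (\sum_(x in A) \sum_(y in A | x \in D y) 1).
      by apply: eq_bigr => x _; rewrite -sum1_card; apply: eq_bigl => y; rewrite !inE.
    rewrite (exchange_big_dep (mem A)) //=; last by move=> x y _ /andP[].
    apply: eq_bigr => y yA; rewrite -sum1_card; apply: eq_bigl => x.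
    by rewrite !inE yA andbC.
  have: \sum_(y in A) #|D y :&: A| <= \sum_(y in A) d.
    by apply: leq_sum => y _; apply: leq_trans (Dd y); apply/subset_leq_card/subsetIl.
  rewrite !sum_nat_const cA; lia.
have cAx : #|A :\ x| = n by move: cA; rewrite (cardsD1 x A) xA => -[].
have [c cP] := IHn _ cAx.
have [k kN] : exists k, k \notin c @: (D x :|: inN x).
    have: #|c @: (D x :|: inN x)| < #|'I_(d + d).+1|.
      rewrite card_ord ltnS (leq_trans (leq_imset_card _ _)) //.
      by rewrite (leq_trans (leq_card_setU _ _)) // leq_add.
    rewrite ltnNge => /negP nfull; apply: NNPP => noK; apply: nfull.
    by apply/subset_leq_card/subsetP => k _; apply/negPn/negP => kN; apply: noK; exists k.
  exists (fun y => if y == x then k else c y) => y z yA zA zDy zy.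
  have kNP t : t \in D x :|: inN x -> k != c t.
    by move=> tN; apply: contraNneq kN => ->; apply: imset_f.
  have [yx|yx] := eqVneq y x; have [zx|zx] := eqVneq z x.
  - by rewrite yx zx eqxx in zy.
  - by apply: kNP; rewrite inE -yx zDy.
  - by rewrite eq_sym; apply: kNP; rewrite !inE yA -zx zDy orbT.
  - by apply: cP => //; rewrite !inE ?yx ?zx.
Qed.

(** * Copies, colour classes and kernels *)

Definition adj (S : finType) (F : graph S) (u v : S) : bool :=
  [set u; v] \in edges F.

Lemma set2_eq (X : finType) (u v x y : X) :
  [set u; v] = [set x; y] -> (u = x /\ v = y) \/ (u = y /\ v = x).
Proof.
move=> uvxy.
have : [/\ u \in [set x; y], v \in [set x; y], x \in [set u; v] & y \in [set u; v]].
  by rewrite uvxy -{1 2}uvxy !inE !eqxx !orbT.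
by rewrite !inE => -[/orP[]/eqP? /orP[]/eqP? /orP[]/eqP? /orP[]/eqP?]; subst; auto.
Qed.

Lemma edgesP (S : finType) (F : graph S) (e : {set S}) :
  e \in edges F -> (e \subset vertices F) && (#|e| == 2).
Proof.
by move=> eF; have /forall_inP/(_ _ eF) : graph_axiom (graph_val F) by case: F {eF}.
Qed.

Lemma adj_sym (S : finType) (F : graph S) : symmetric (adj F).
Proof. by move=> u v; rewrite /adj setUC. Qed.

Lemma adjP (S : finType) (F : graph S) (u v : S) :
  adj F u v -> [/\ u != v, u \in vertices F & v \in vertices F].
Proof.
move=> /edgesP /andP[/subsetP sub]; rewrite cards2 eqSS eqb1 => uv.
by split=> //; apply: sub; rewrite !inE eqxx ?orbT.
Qed.

Definition copy (S U : finType) (F : graph S) (E : {set {set U}}) (h : S -> U) :=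
  {in vertices F &, injective h} /\
  forall u v, adj F u v -> [set h u; h v] \in E.

Lemma copy_sub (S U : finType) (F : graph S) (E E' : {set {set U}}) h :
  E \subset E' -> copy F E h -> copy F E' h.
Proof. by move=> /subsetP EE' [hI hE]; split=> // u v /hE /EE'. Qed.

Definition ramsey (S U : finType) (F : graph S) (E : {set {set U}}) (r : nat) :=
  forall c : {set U} -> 'I_r, exists h : S -> U, copy F E h /\
    exists k, forall u v, adj F u v -> c [set h u; h v] = k.

Lemma ramsey_le (S U : finType) (F : graph S) (E : {set {set U}}) r s :
  r <= s -> ramsey F E s -> ramsey F E r.
Proof.
move=> rs sE c; have [h [hE [k kP]]] := sE (fun e => widen_ord rs (c e)).
have [[u v] /= uv|noE] := pickP (fun p : S * S => adj F p.1 p.2).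
  exists h; split=> //; exists (c [set h u; h v]) => a b ab.
  by have /(congr1 val) /= := etrans (kP _ _ ab) (esym (kP _ _ uv)) => /val_inj.
exists h; split=> //.
(* [F] has no edges here, so any colour serves. *)
exists (c set0) => a b ab; by have := noE (a, b); rewrite /= ab.
Qed.

Definition colour_class (U : finType) (E : {set {set U}}) r (c : {set U} -> 'I_r) k :=
  [set e in E | c e == k].

Lemma colour_class_sub (U : finType) (E : {set {set U}}) r (c : {set U} -> 'I_r) k :
  colour_class E c k \subset E.
Proof. by apply/subsetP => e; rewrite inE => /andP[]. Qed.

(** If every class [k] had a bad colouring [d k] with [s] colours, the pair [(c e, d (c e) e)],
    coded as a number below [r * s], would be a bad colouring of [E]. *)
Lemma ramsey_class (S U : finType) (F : graph S) (E : {set {set U}}) r s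
    (c : {set U} -> 'I_r) (a b : S) :
  adj F a b -> ramsey F E (r * s) -> exists k, ramsey F (colour_class E c k) s.
Proof.
move=> ab rsE; apply: NNPP => noK.
have : forall k, exists d : {ffun {set U} -> 'I_s},
    ~ exists h : S -> U, copy F (colour_class E c k) h /\
        exists l, forall u v, adj F u v -> d [set h u; h v] = l.
  move=> k; apply: NNPP => noD; apply: noK; exists k => d.
  apply: NNPP => noH; apply: noD; exists [ffun e => d e] => -[h [hE [l lP]]].
  by apply: noH; exists h; split=> //; exists l => u v /lP; rewrite ffunE.
move=> /fin_all_exists[d dP].
have lt_rs (i : 'I_r) (j : 'I_s) : i * s + j < r * s.
  by rewrite (leq_trans (n := i.+1 * s)) ?leq_mul2r ?ltn_ord ?orbT // mulSn addnC ltn_add2r.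
have [h [[hI hE] [k kP]]] := rsE (fun e => Ordinal (lt_rs (c e) (d (c e) e))).
have eq_cd u v : adj F u v -> c [set h u; h v] = c [set h a; h b] /\
    d (c [set h u; h v]) [set h u; h v] = d (c [set h a; h b]) [set h a; h b].
  move=> uv; have := etrans (kP _ _ uv) (esym (kP _ _ ab)) => /(congr1 val) /=.
  move: (d _ _) (d _ _) => j j' ejj.
  have s0 : 0 < s by apply: leq_ltn_trans (ltn_ord j).
  have := congr1 (divn^~ s) ejj; have := congr1 (modn^~ s) ejj.
  rewrite !modnMDl !divnMDl // !modn_small // !divn_small // !addn0.
  by move=> /val_inj -> /val_inj ->.
apply: (dP (c [set h a; h b])); exists h; split.
  by split=> // u v uv; rewrite inE hE //= (eq_cd u v uv).1.
by exists (d (c [set h a; h b]) [set h a; h b]) => u v /eq_cd[<- ->].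
Qed.

Definition flexible (S U : finType) (F : graph S) (E : {set {set U}}) (M : nat)
    (h : S -> U) (K : {set S}) :=
  forall W : {set U}, #|W| <= M -> exists h', [/\ copy F E h',
    {in K, h' =1 h} & {in vertices F :\: K, forall s, h' s \notin W}].

(** Bounds one growth step on [B] vertices: at most [M] new ones for each [K] and each map from [S]
    into the old ones. *)
Definition witness_growth (S : finType) (M B : nat) : nat :=
  B + 2 ^ #|S| * (B ^ #|S| * M).

Lemma flexible_eq (S U : finType) (F : graph S) (E : {set {set U}}) M h g (K : {set S}) :
  {in K, h =1 g} -> flexible F E M h K -> flexible F E M g K.
Proof.
move=> hg fl W /fl[h' [h'E h'K h'W]]; exists h'; split=> // s sK.
by rewrite h'K ?hg.
Qed.

Lemma leq_exp m n e : m <= n -> m ^ e <= n ^ e.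
Proof. by move=> mn; elim: e => // e IHe; rewrite !expnS leq_mul. Qed.

Lemma card_bigcup_le (I U : finType) (P : {pred I}) (A : I -> {set U}) m :
  (forall i, #|A i| <= m) -> #|\bigcup_(i in P) A i| <= #|P| * m.
Proof.
move=> Am; rewrite -sum_nat_const.
elim/big_ind2: _ => [|X x Y y Xx Yy|i _]; rewrite ?cards0 //.
by rewrite (leq_trans (leq_card_setU _ _)) // leq_add.
Qed.

(* If no such K exists for a copy h and an edge uv, the witnesses against
   flexibility trap the copy, starting from the image of uv, inside a set of
   bounded size, until a second edge of the copy lies in it; that edge is made
   to receive a different colour. *)
Lemma monochromatic_flexible (S : finType) (F : graph S) (M : nat) :
  exists r, forall (U : finType) (E : {set {set U}}), exists c : {set U} -> 'I_r.+1,
  forall h, copy F E h ->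
  (exists k, forall u v, adj F u v -> c [set h u; h v] = k) ->
  forall u v, adj F u v -> exists K : {set S}, [/\ K \subset vertices F,
    u \in K, v \in K, {in K &, forall a b, adj F a b -> [set a; b] = [set u; v]}
    & flexible F E M h K].
Proof.
set B := iter #|S| (witness_growth S M) 2.
exists (B ^ 2 + B ^ 2) => U E.
(* Unless [g] is flexible on [K], the set [Wit (K, g)] meets the part outside [K] of every copy that
   agrees with [g] on [K]. *)
have : forall Kg : {set S} * {ffun S -> U}, exists W : {set U}, #|W| <= M /\
    (flexible F E M Kg.2 Kg.1 \/ forall h', copy F E h' -> {in Kg.1, h' =1 Kg.2} ->
       exists2 s, s \in vertices F :\: Kg.1 & h' s \in W).
  move=> [K g] /=; apply: NNPP => noW.
  apply: (noW); exists set0; rewrite cards0; split=> //; left => W WM.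
  apply: NNPP => noH; apply: noW; exists W; split=> //; right => h' h'E h'K.
  apply: NNPP => noS; apply: noH; exists h'; split=> // s sK.
  by apply/negP => sW; apply: noS; exists s.
move=> /fin_all_exists[Wit WitP].
pose grow (A : {set U}) := A :|: \bigcup_(K in {: {set S}})
   \bigcup_(g in ffun_on_mem S (mem A)) Wit (K, g).
have grow_sub (A : {set U}) : A \subset grow A by apply: subsetUl.
have card_grow (A : {set U}) b : #|A| <= b -> #|grow A| <= witness_growth S M b.
  move=> Ab; rewrite (leq_trans (leq_card_setU _ _)) // leq_add //.
  have -> : 2 ^ #|S| = #|{: {set S}}|.
    by rewrite -cardsT -(card_powerset [set: S]) powersetT !cardsT.
  apply: card_bigcup_le => K.
  have cA : #|A| ^ #|S| * M <= b ^ #|S| * M by rewrite leq_mul2r leq_exp ?orbT.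
  apply: leq_trans cA; rewrite -(card_ffun_on S (mem A)).
  by apply: card_bigcup_le => g; have [] := WitP (K, g).
have iter_sub (A : {set U}) t t' : t <= t' -> iter t grow A \subset iter t' grow A.
  move=> /subnKC <-; elim: (t' - t) => [|j IHj]; first by rewrite addn0.
  by rewrite addnS; apply: subset_trans IHj (grow_sub _).
have card_iter (A : {set U}) : #|A| <= 2 -> #|iter #|S| grow A| <= B.
  by move=> A2; rewrite /B; elim: #|S| => // j IHj; apply: card_grow.
(* The pairs trapped around [e], which must not share its colour; only two-element [e] matter, and
   for them the growth is bounded by [B]. *)
pose D (e : {set U}) := if #|e| == 2 then
  [set [set p.1; p.2] | p in setX (iter #|S| grow e) (iter #|S| grow e)] else set0.
have D_card e : #|D e| <= B ^ 2.
  rewrite /D; case: eqP => [e2|_]; last by rewrite cards0.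
  rewrite (leq_trans (leq_imset_card _ _)) // cardsX -mulnn leq_mul //;
  by rewrite card_iter ?e2.
have [c cP] := bounded_out_degree_colouring D_card.
exists c => h [hI hE] [k kP] u v uv; apply: NNPP => noK.
have [u_v uV vV] := adjP uv.
set e := [set h u; h v].
have e2 : #|e| = 2 by rewrite cards2 (contra_neq (hI u v uV vV)).
(* Each growth step traps one more vertex; after [#|S|] steps [K] would be larger than [S]. *)
have claim t : t <= #|S| -> exists K : {set S}, [/\ K \subset vertices F,
    u \in K /\ v \in K, {in K &, forall a b, adj F a b -> [set a; b] = [set u; v]},
    t < #|K| & {in K, forall s, h s \in iter t grow e}].
  elim: t => [_|t IHt tS].
    exists [set u; v]; split; rewrite ?inE ?eqxx ?orbT ?cards2 ?u_v //.
    - by apply/subsetP => s; rewrite !inE => /orP[]/eqP->.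
    - move=> a b; rewrite !inE => /orP[]/eqP-> /orP[]/eqP-> // /adjP[];
      by rewrite ?eqxx // setUC.
    - by move=> s; rewrite !inE => /orP[]/eqP->; rewrite eqxx ?orbT.
  have [K [KV [uK vK] Ke tK Kh]] := IHt (ltnW tS).
  have nofl : ~ flexible F E M h K by move=> fl; apply: noK; exists K.
  (* Only the values on [K] matter; the filler [h u] keeps [g] inside the current set. *)
  pose g := [ffun s => if s \in K then h s else h u].
  have hg : {in K, h =1 g} by move=> s sK; rewrite ffunE sK.
  have [_ [/= fl|/(_ h (conj hI hE) hg)[s]]] := WitP (K, g).
    by case: nofl; apply: flexible_eq fl => s sK; rewrite -hg.
  rewrite inE => /andP[sK sV] sW.
  have st : h s \in iter t.+1 grow e.
    rewrite inE; apply/orP; right; apply/bigcupP; exists K => //.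
    apply/bigcupP; exists g => //; apply/ffun_onP => x; rewrite ffunE.
    by case: ifP => xK; apply: Kh.
  have Kst : {in K, forall x, h x \in iter t.+1 grow e}.
    by move=> x /Kh; apply/subsetP/grow_sub.
  (* An edge from [s] into [K] would be a trapped pair other than [e], hence of another colour. *)
  have s_new a : a \in K -> ~~ adj F s a.
    move=> aK; apply/negP => sa.
    have aV := subsetP KV a aK.
    have /negP[] : c e != c [set h s; h a].
      apply: cP.
        rewrite /D e2 eqxx; apply/imsetP; exists (h s, h a) => //.
        by rewrite inE /= !(subsetP (iter_sub _ _ _ tS)) // Kst.
      apply: contraNneq sK => eq_e.
      have: h s \in e by rewrite -eq_e !inE eqxx.
      by rewrite !inE => /orP[]/eqP/hI-> //.
    by rewrite !kP.
  exists (s |: K); split.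
  - by rewrite subUset sub1set sV.
  - by rewrite !inE uK vK !orbT.
  - move=> a b; rewrite !inE => /predU1P[->|aK] /predU1P[->|bK] ab.
    + by have [/eqP] := adjP ab.
    + by have := s_new _ bK; rewrite ab.
    + by have := s_new _ aK; rewrite adj_sym ab.
    + exact: Ke.
  - by rewrite cardsU1 sK.
  - by move=> x; rewrite in_setU1 => /predU1P[->|/Kst].
have [K [_ _ _ SK _]] := claim _ (leqnn _).
by have := leq_trans SK (max_card _); rewrite ltnn.
Qed.

(** * Rich edges *)

Definition rich (S U : finType) (F : graph S) (m : nat) (E : {set {set U}})
    (e : {set U}) :=
  forall W : {set U}, #|W| <= m -> exists h u v,
    [/\ copy F E h, adj F u v, [set h u; h v] = e
      & forall s, s \in vertices F -> s != u -> s != v -> h s \notin W].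

Definition forces_rich (S : finType) (F : graph S) (m : nat) :=
  exists r, forall (U : finType) (E : {set {set U}}),
    ramsey F E r.+1 -> exists2 e, e \in E & rich F m E e.

(** If [F] has edges, the copy required at the bottom rules out chains of empty sets. *)
Fixpoint deep (S U : finType) (F : graph S) (m k : nat) (E : {set {set U}}) :=
  if k is k'.+1 then exists E' : {set {set U}}, [/\ E' \subset E,
    forall e, e \in E' -> rich F m E e & deep F m k' E']
  else exists h, copy F E h.

Lemma rich_sub (S U : finType) (F : graph S) m (E E' : {set {set U}}) e :
  E \subset E' -> rich F m E e -> rich F m E' e.
Proof.
move=> EE' eR W /eR[h [u [v [hE uv he hW]]]]; exists h, u, v; split=> //.
exact: copy_sub hE.
Qed.

Lemma deep_copy (S U : finType) (F : graph S) m k (E : {set {set U}}) :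
  deep F m k E -> exists h, copy F E h.
Proof.
elim: k E => // k IHk E [E' [EE' _ /IHk[h hE']]].
by exists h; apply: copy_sub hE'.
Qed.

Lemma exists_set (X : finType) (P : X -> Prop) :
  exists A : {set X}, forall x, x \in A <-> P x.
Proof.
have /fin_all_exists[b bP] x : exists b : bool, b <-> P x.
  by have [Px|nPx] := classic (P x); [exists true|exists false].
by exists [set x | b x] => x; rewrite inE.
Qed.

(** Each level costs a factor 2 in the number of colours, spent on separating rich from non-rich
    edges. *)
Lemma ramsey_deep (S : finType) (F : graph S) m (a b : S) :
  adj F a b -> forces_rich F m ->
  forall k, exists r, forall (U : finType) (E : {set {set U}}),
    ramsey F E r.+1 -> deep F m k E.
Proof.
move=> ab [s sP] k.
suff H (U : finType) (E : {set {set U}}) : ramsey F E (2 ^ k * s.+1) -> deep F m k E.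
  exists (2 ^ k * s.+1) => U E rE; apply: H.
  by apply: ramsey_le rE.
elim: k E => [|k IHk] E; first by rewrite mul1n => /(_ (fun=> ord0))[h [hE _]]; exists h.
rewrite expnS -mulnA => rE.
have [R RP] := exists_set (rich F m E).
pose c e : 'I_2 := if e \in R then ord_max else ord0.
have [k' k'P] := ramsey_class c ab rE.
have [k'1|k'0] := eqVneq k' ord_max.
  exists (colour_class E c k'); split; first exact: colour_class_sub.
    by move=> e; rewrite inE k'1 /c => /andP[_]; case: ifP => // /RP.
  exact: IHk.
(* This class consists of non-rich edges, yet it has an edge rich in it and therefore in [E]. *)
have: ramsey F (colour_class E c k') s.+1.
  by apply: ramsey_le k'P; rewrite -{1}[s.+1]mul1n leq_mul2r expn_gt0.
move=> /sP[e ec /rich_sub]-/(_ _ (colour_class_sub _ _ _))/RP eR.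
by move: ec; rewrite inE /c eR => /andP[_]; rewrite eq_sym (negPf k'0).
Qed.

(** * Rich edges for complete multipartite graphs *)

Lemma complete_multipartite_adj (S : finType) (F : graph S) (P : {set {set S}}) :
  edges F = [set [set x; y] | x in vertices F, y in vertices F
                                  & pblock P x != pblock P y] ->
  forall u v, adj F u v =
    [&& u \in vertices F, v \in vertices F & pblock P u != pblock P v].
Proof.
move=> FE u v; rewrite /adj FE; apply/imset2P/and3P => [[x y xV]|[uV vV uv]].
  rewrite inE => /andP[yV xy] uvxy.
  by have [[-> ->]|[-> ->]] := set2_eq uvxy; rewrite // eq_sym.
by exists u v => //; rewrite inE vV.
Qed.

Lemma multipartite_forces_rich (S : finType) (F : graph S) m :
  is_balanced_complete_multipartite F -> 0 < #|edges F| -> forces_rich F m.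
Proof.
move=> [P [partP _ FE]] /card_gt0P[e eF].
have adjE := complete_multipartite_adj FE.
have [a [b ab]] : exists a b, adj F a b.
  by move: (eF); rewrite FE => /imset2P[a b _ _ eab]; exists a, b; rewrite /adj -eab.
have [r rP] := monochromatic_flexible F m.
exists r => U E rE; have [c cP] := rP _ E.
have [h [[hI hE] hc]] := rE c.
exists [set h a; h b]; first exact: hE.
have [K [KV aK bK Ke fl]] := cP h (conj hI hE) hc a b ab.
move=> W /fl[h' [h'E h'K h'W]]; exists h', a, b; split=> //; first by rewrite !h'K.
move=> s sV sa sb; apply: h'W; rewrite inE sV andbT; apply/negP => sK.
have [_ aV bV] := adjP ab.
have sNab t : t \in [set a; b] -> ~~ adj F s t.
  move=> tab; apply/negP => st; have tK : t \in K by case/set2P: tab => ->.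
  have: s \in [set a; b] by rewrite -(Ke _ _ sK tK st) !inE eqxx.
  by rewrite !inE (negPf sa) (negPf sb).
have := sNab a; have := sNab b; rewrite !inE !eqxx orbT !adjE sV aV bV /= !negbK.
move=> /(_ isT)/eqP sb' /(_ isT)/eqP sa'.
by move: ab; rewrite adjE -sa' sb' eqxx !andbF.
Qed.

(** * Rich edges for cycles *)

(** Positions are natural numbers read modulo [n], which turns rotations and reflections into
    arithmetic. *)
Lemma cycle_positions (S : finType) (F : graph S) : is_cycle F ->
  exists n (pos : nat -> S) (ind : S -> nat), [/\ 3 <= n,
    forall i j, pos i = pos j <-> i = j %[mod n],
    forall i, pos i \in vertices F,
    {in vertices F, cancel ind pos}
  & forall u v, adj F u v <-> exists i,
      (u = pos i /\ v = pos i.+1) \/ (v = pos i /\ u = pos i.+1)].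
Proof.
move=> [s [s3 sU FV FE]].
have [x0 s0] : exists x0, x0 \in s by case: s s3 {sU FV FE} => // x s _; exists x; rewrite inE eqxx.
have s_gt0 : 0 < size s by apply: leq_trans s3.
pose pos i := nth x0 s (i %% size s).
have posV i : pos i \in s by rewrite mem_nth ?ltn_mod.
have posP i j : pos i = pos j <-> i = j %[mod size s].
  split=> [/eqP|eij]; last by rewrite /pos eij.
  by rewrite nth_uniq ?ltn_mod // => /eqP.
have indK x : x \in s -> pos (index x s) = x.
  by move=> xs; rewrite /pos modn_small ?nth_index ?index_mem.
have posS i : next s (pos i) = pos i.+1.
  rewrite next_nth posV /pos -addn1 -modnDml addn1.
  rewrite index_uniq ?ltn_mod //.
  have: i %% size s < size s by rewrite ltn_mod.
  move: (i %% size s) => k.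
  case: s {s3 sU FV FE s0 s_gt0 pos posV posP indK} => // y s /= ks.
  (* For [k = size s] the default [y] of [nth], the head of the list, is the wrap-around. *)
  have [{}ks|sk|->] := ltngtP k (size s).
  - by rewrite modn_small //= (set_nth_default x0).
  - by rewrite ltnNge -ltnS ks in sk.
  - by rewrite modnn nth_default.
exists (size s), pos, (index^~ s); split=> //.
- by move=> i; rewrite FV inE.
- by move=> x; rewrite FV inE; apply: indK.
move=> u v; rewrite /adj FE; split=> [/imsetP[x xs uvx]|].
  exists (index x s); rewrite -posS indK //.
  by have [[-> ->]|[-> ->]] := set2_eq uvx; [left|right].
by case=> i [][-> ->]; [|rewrite setUC]; apply/imsetP; exists (pos i); rewrite ?posS.
Qed.

Definition lcycle (U : finType) (n : nat) (E : {set {set U}}) (l : nat -> U) :=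
  (forall i j, l i = l j <-> i = j %[mod n]) /\
  forall i, [set l i; l i.+1] \in E.

Definition periodic (n : nat) (K : pred nat) :=
  forall i j, i = j %[mod n] -> K i = K j.

Definition lflexible (U : finType) (n : nat) (E : {set {set U}}) (m : nat)
    (l : nat -> U) (K : pred nat) :=
  forall W : {set U}, #|W| <= m -> exists l', [/\ lcycle n E l',
    forall i, K i -> l' i = l i & forall i, ~~ K i -> l' i \notin W].

(** For [q = n.-2] the bound on [K] is void; for [q = 0] the kernel is just the pair of positions 0
    and 1. *)
Definition narrow (U : finType) (n : nat) (E : {set {set U}}) (m q : nat) :=
  exists l K, [/\ periodic n K, K q /\ K q.+1, forall i, K i -> i %% n <= q.+1
    & lflexible n E m l K].

Lemma lcycle_shift (U : finType) n (E : {set {set U}}) l k :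
  lcycle n E l -> lcycle n E (fun i => l (i + k)).
Proof.
move=> [lI lE]; split=> [i j|i]; last by rewrite addSn.
by rewrite lI; split=> /eqP ij; apply/eqP; rewrite eqn_modDr in ij *.
Qed.

Lemma periodic_shift n K k : periodic n K -> periodic n (fun i => K (i + k)).
Proof. by move=> Kn i j ij; apply: Kn; apply/eqP; rewrite eqn_modDr ij. Qed.

Lemma lflexible_shift (U : finType) n (E : {set {set U}}) m l K k :
  lflexible n E m l K ->
  lflexible n E m (fun i => l (i + k)) (fun i => K (i + k)).
Proof.
move=> fl W /fl[l' [l'E l'K l'W]]; exists (fun i => l' (i + k)).
split=> [|i|i]; [exact: lcycle_shift | exact: l'K | exact: l'W].
Qed.

(* Multiplication by [n.-1] is negation modulo [n]. *)
Definition reflect_at (n k i : nat) := k + n.-1 * i.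

Lemma reflect_at_mod n k i j : 0 < n ->
  reflect_at n k i = reflect_at n k j %[mod n] <-> i = j %[mod n].
Proof.
move=> n0; have H x y : x = y %[mod n] -> reflect_at n k x = reflect_at n k y %[mod n].
  by move=> xy; rewrite /reflect_at -modnDmr -modnMmr xy modnMmr modnDmr.
split; last exact: H.
move=> /eqP; rewrite eqn_modDl => /eqP ij.
(* The square of [n.-1] is 1 modulo [n]. *)
have K x : n.-1 * (n.-1 * x) = x %[mod n].
  case: n n0 {H ij} => // n _ /=; case: n => [|n]; first by rewrite !modn1.
  have -> : n.+1 * (n.+1 * x) = n * x * n.+2 + x by lia.
  by rewrite modnMDl.
by rewrite -K -modnMmr ij modnMmr K.
Qed.

Lemma lflexible_reflect (U : finType) n (E : {set {set U}}) m l K k : 0 < n ->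
  lflexible n E m l K ->
  lflexible n E m (l \o reflect_at n k) (K \o reflect_at n k).
Proof.
move=> n0 fl W /fl[l' [[l'I l'E] l'K l'W]]; exists (l' \o reflect_at n k).
split=> [|i|i]; [|exact: l'K|exact: l'W].
split=> [i j|i] /=; first by rewrite l'I reflect_at_mod.
rewrite setUC; have := l'E (reflect_at n k i.+1).
suff -> : l' (reflect_at n k i.+1).+1 = l' (reflect_at n k i) by [].
apply/l'I; rewrite /reflect_at.
have -> : (k + n.-1 * i.+1).+1 = n + (k + n.-1 * i) by lia.
by rewrite modnDl.
Qed.

(** A residue [i] above [k] is sent to [k + n - i], which is again above [k]. *)
Lemma reflect_at_le n k i : k < n -> reflect_at n k i %% n <= k -> i %% n <= k.
Proof.
move=> kn; have n0 : 0 < n by apply: leq_ltn_trans kn.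
have : i %% n < n by rewrite ltn_mod.
have -> : reflect_at n k i = reflect_at n k (i %% n) %[mod n].
  by apply/reflect_at_mod; rewrite ?modn_mod.
move: (i %% n) => j jn; apply: contraTT; rewrite -!ltnNge => kj.
have -> : reflect_at n k j = j.-1 * n + (k + n - j).
  rewrite /reflect_at; nia.
rewrite modnMDl modn_small; lia.
Qed.

(** Position [n.-1] is a neighbour of 0, so a kernel spanning only the edge (0, 1) omits it. *)
Definition locally_flexible (U : finType) (n : nat) (E E' : {set {set U}}) (M : nat) :=
  forall l, lcycle n E l -> exists K, [/\ periodic n K, K 0, K 1, ~~ K n.-1
    & lflexible n E' M l K].

(** Start of the descent: a shift by 2 turns the edge (0, 1) into (n - 2, n - 1). *)
Lemma lflexible_narrow (U : finType) n (E : {set {set U}}) m l K : 3 <= n ->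
  periodic n K -> K 0 -> K 1 -> lflexible n E m l K -> narrow n E m n.-2.
Proof.
move=> n3 Kn K0 K1 fl; exists (fun i => l (i + 2)), (fun i => K (i + 2)); split.
- exact: periodic_shift.
- split; [rewrite (Kn _ 0) // | rewrite (Kn _ 1) //].
    have -> : n.-2 + 2 = 0 + n by lia.
    by rewrite modnDr.
  have -> : n.-2.+1 + 2 = 1 + n by lia.
  by rewrite modnDr.
- by move=> i _; have : i %% n < n; [rewrite ltn_mod; lia | lia].
- exact: lflexible_shift.
Qed.

(** The arc of [g] from 0 to [i] is closed up by the arc of [g'] from [i] to [n]; the cycles agree
    at both joints, and the new arc avoids [g] in between. *)
Lemma splice_lcycle (U : finType) n (E : {set {set U}}) (g g' : nat -> U) i :
  0 < i < n -> lcycle n E g -> lcycle n E g' -> g' 0 = g 0 -> g' i = g i ->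
  (forall x y, i < y %% n -> g x <> g' y) ->
  lcycle n E (fun x => if x %% n <= i then g x else g' x).
Proof.
move=> /andP[i0 i_n] [gI gE] [g'I g'E] g0 gi gg'; split=> [x y|x].
  case: leqP => xi; case: leqP => yi; [exact: gI| | |exact: g'I].
    by split=> [/(gg' _ _ yi)//|xy]; rewrite -xy ltnNge xi in yi.
  by split=> [/esym/(gg' _ _ xi)//|xy]; rewrite xy ltnNge yi in xi.
have n0 : 0 < n by lia.
have xn : x %% n < n by rewrite ltn_mod.
have eq_mod (f : nat -> U) y z : (forall i j, f i = f j <-> i = j %[mod n]) ->
    y %% n = z -> z < n -> f y = f z.
  by move=> fI yz zn; apply/fI; rewrite yz modn_small.
have xS : x.+1 %% n = if x %% n == n.-1 then 0 else (x %% n).+1.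
  rewrite -addn1 -modnDml addn1; case: eqP => [->|xn1]; last by rewrite modn_small; lia.
  by rewrite prednK // modnn.
have [xi|ix] := ltnP (x %% n) i.
  by rewrite (ltnW xi) xS; case: eqP => [|_]; [lia | rewrite xi gE].
have -> : (if x %% n <= i then g x else g' x) = g' x.
  case: leqP => // xi; have xi' : x %% n = i by apply/eqP; rewrite eqn_leq xi.
  by rewrite (eq_mod g _ i) // (eq_mod g' _ i) // gi.
have -> : (if x.+1 %% n <= i then g x.+1 else g' x.+1) = g' x.+1; last exact: g'E.
rewrite xS; case: eqP => xn1; last by rewrite ltnNge ix.
by rewrite (eq_mod g _ 0) ?(eq_mod g' _ 0) ?xS ?xn1 ?eqxx.
Qed.

(* A kernel inside [0, q + 1] with common edge (q, q + 1) shrinks by one: either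
   the kernel of the edge (1, 2) of some cycle is already shorter, or it
   contains a position beyond q + 1, and replacing the path from there to 1 by
   a fresh one frees position 0. *)
Lemma narrow_step (U : finType) n (E E' : {set {set U}}) m q : q.+2 < n ->
  E \subset E' -> locally_flexible n E E' (m + n) -> narrow n E m q.+1 ->
  narrow n E' m q.
Proof.
move=> qn /subsetP EE' good [l [K [Kn [Kq Kq1] Kle fl]]]; apply: NNPP => nonarrow.
have n0 : 0 < n by lia.
apply: (nonarrow).
(* The shift moves the old position 0, now dropped from the kernel, to [n.-1]. *)
exists (fun i => l (i + 1)), (fun i => K (i + 1) && ((i + 1) %% n != 0)).
have modS i : (i + 1) %% n != 0 -> (i + 1) %% n = (i %% n).+1.
  rewrite -modnDml addn1; have [->|iN] := eqVneq (i %% n) n.-1.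
    by rewrite prednK // modnn.
  have : i %% n < n by rewrite ltn_mod.
  by move=> *; rewrite modn_small //; lia.
split.
- move=> i j ij; have ij1 : i + 1 = j + 1 %[mod n] by apply/eqP; rewrite eqn_modDr ij.
  by rewrite (Kn _ _ ij1) ij1.
- by rewrite !addn1 Kq Kq1 !modn_small //; lia.
- by move=> i /andP[/Kle iq] /modS im; rewrite im in iq.
move=> W Wm; have [h [hE hK hW]] := fl W Wm.
pose g i := h (i + 1).
have gE : lcycle n E g := lcycle_shift 1 hE.
have gE' : lcycle n E' g by case: gE => gI gE; split=> // i; apply: EE'.
have [Kg [Kgn Kg0 Kg1 Kgn1 gfl]] := good g gE.
have Kgm i : Kg (i %% n) = Kg i by apply: Kgn; rewrite modn_mod.
have [i [i_n Kgi iq imax]] : exists i, [/\ i < n, Kg i, q.+1 < i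
    & forall j, i < j %% n -> ~~ Kg j].
  (* If [Kg] stays within [0, q + 1], reflecting [i] to [q + 1 - i] carries its edge (0, 1) to (q, q
     + 1), against [nonarrow]. *)
  have [far|near] := classic (exists i, Kg i /\ q.+1 < i %% n); last first.
    case: nonarrow; exists (g \o reflect_at n q.+1), (Kg \o reflect_at n q.+1).
    split; last 1 first.
    - apply: lflexible_reflect => // W' W'm; apply: gfl; lia.
    - by move=> i j ij; apply: Kgn; apply/reflect_at_mod.
    - split=> /=.
        rewrite (Kgn _ 1) //; rewrite /reflect_at.
        have -> : q.+1 + n.-1 * q = q * n + 1 by nia.
        by rewrite modnMDl.
      rewrite (Kgn _ 0) //; rewrite /reflect_at.
      have -> : q.+1 + n.-1 * q.+1 = q.+1 * n + 0 by nia.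
      by rewrite modnMDl.
    - move=> i /= Ki; apply: (@reflect_at_le n); first by lia.
      by rewrite leqNgt; apply/negP => iq; apply: near; exists (reflect_at n q.+1 i).
  case: far => j [Kj jq].
  have exi : exists i, (i < n) && Kg i by exists (j %% n); rewrite ltn_mod n0 Kgm.
  have ubi i : (i < n) && Kg i -> i <= n by case/andP=> /ltnW.
  case: (ex_maxnP exi ubi) => i /andP[i_n Ki] imax; exists i; split=> //.
    by apply: leq_trans (imax (j %% n) _); rewrite // ltn_mod n0 Kgm.
  move=> k ik; apply: contraTN ik => Kk; rewrite -leqNgt.
  by apply: imax; rewrite ltn_mod n0 Kgm.
(* Making the new arc avoid the vertices of [h] costs the extra [n] in [m + n]. *)
pose H := [set h (val x) | x : 'I_n].
have hH x : h x \in H.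
  apply/imsetP; exists (Ordinal (ltn_pmod x n0)) => //=.
  by case: hE => hI _; apply/hI; rewrite modn_mod.
have WH : #|W :|: H| <= m + n.
  rewrite (leq_trans (leq_card_setU _ _)) // leq_add //.
  by rewrite (leq_trans (leq_imset_card _ _)) ?card_ord.
have [g' [g'E g'K g'WH]] := gfl _ WH.
(* Hence the new arc covers position [n.-1], while the kernel, within [0, q + 1], stays on [g]. *)
have i_n1 : i != n.-1 by apply: contraNneq Kgn1 => <-.
exists (fun x => if x %% n <= i then g x else g' x); split.
- apply: splice_lcycle => //; [lia|exact: g'K|exact: g'K|].
  move=> x y /imax /g'WH; rewrite inE negb_or => /andP[_ /negP yH] xy.
  by apply: yH; rewrite -xy; apply: hH.
- move=> x /andP[Kx /modS xm].
  have xq := Kle _ Kx; rewrite xm in xq.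
  by rewrite (_ : x %% n <= i) ?/g ?hK //; lia.
- move=> x; case: leqP => [xi|/imax/g'WH]; last by rewrite in_setU negb_or => /andP[].
  move=> xK; apply: hW; move: xK; apply: contra => -> /=.
  apply: contraTneq xi => x0; rewrite -ltnNge.
  have : x %% n = n.-1; last lia.
  apply: NNPP => xn; have : x %% n < n by rewrite ltn_mod.
  by move=> xn'; move: x0; rewrite -modnDml addn1 modn_small; lia.
Qed.

Lemma cycle_forces_rich (S : finType) (F : graph S) m : is_cycle F -> forces_rich F m.
Proof.
move=> /cycle_positions[n [pos [ind [n3 posP posV indK adjE]]]].
have adjS i : adj F (pos i) (pos i.+1) by apply/adjE; exists i; left.
have ind_pos i : ind (pos i) = i %[mod n] by apply/posP; rewrite indK.
have [r rP] := monochromatic_flexible F (m + n).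
have copy_l (U : finType) (E : {set {set U}}) h :
    copy F E h -> lcycle n E (h \o pos).
  move=> [hI hE]; split=> [i j|i]; last exact: hE.
  split=> [/= hij|/posP /= -> //]; by apply/posP/hI.
have l_copy (U : finType) (E : {set {set U}}) l :
    lcycle n E l -> copy F E (l \o ind) /\ forall i, (l \o ind) (pos i) = l i.
  move=> [lI lE]; have lp i : (l \o ind) (pos i) = l i by apply/lI.
  split=> //; split=> [u v uV vV /= /lI /posP|u v /adjE[i]]; first by rewrite !indK.
  by case=> -[-> ->]; rewrite !lp // setUC.
(* All cycles in one colour class are monochromatic, so each has kernels that are flexible in
   [E]. *)
have descend (U : finType) (E : {set {set U}}) s : ramsey F E (r.+1 * s) ->
    exists E' : {set {set U}}, [/\ E' \subset E, ramsey F E' s & locally_flexible n E' E (m + n)].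
  move=> rE; have [c cP] := rP _ E; have [k rk] := ramsey_class c (adjS 0) rE.
  have kE := colour_class_sub E c k.
  exists (colour_class E c k); split=> // l /l_copy[hE hl].
  have hc : exists k, forall u v, adj F u v -> c [set (l \o ind) u; (l \o ind) v] = k.
    by exists k => u v uv; case: hE => _ /(_ _ _ uv); rewrite inE => /andP[_ /eqP].
  have [K [KV uK vK Ke fl]] := cP _ (copy_sub kE hE) hc _ _ (adjS 0).
  exists (fun i => pos i \in K); split=> //.
  - by move=> i j ij; rewrite (proj2 (posP i j) ij).
  - apply/negP => n1K; have eq0 : pos n.-1.+1 = pos 0.
      by apply/posP; rewrite prednK ?modnn ?mod0n //; lia.
    have := adjS n.-1; rewrite eq0 => /(Ke _ _ n1K uK) /set2_eq.
    by case=> -[/posP]; rewrite (modn_small (m := n.-1)) ?mod0n ?(modn_small (m := 1)); lia.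
  - move=> W /fl[h' [h'E h'K h'W]]; exists (h' \o pos); split; first exact: copy_l.
    + by move=> i iK /=; rewrite h'K.
    + by move=> i iK; apply: h'W; rewrite inE iK posV.
(* The innermost of the [j.+1] descents gives index [n.-2], and each outer one lowers it by one. *)
have main j (U : finType) (E : {set {set U}}) : j <= n.-2 ->
    ramsey F E (r.+1 ^ j.+1) -> narrow n E m (n.-2 - j).
  elim: j E => [|j IHj] E jn; rewrite expnS => /descend[E' [E'E rE' good]].
    have [h [/copy_l /good[K [Kn K0 K1 _ fl]] _]] := rE' (fun=> ord0).
    rewrite subn0; apply: (lflexible_narrow n3 Kn K0 K1) => W Wm.
    by apply: fl; rewrite (leq_trans Wm) ?leq_addr.
  apply: (narrow_step _ E'E good); first by lia.
  by rewrite -subSn // subSS; apply: IHj => //; apply: ltnW.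
exists (r.+1 ^ n.-1) => U E rE.
have [l [K [Kn [K0 K1] Kle fl]]] : narrow n E m 0.
  rewrite -(subnn n.-2); apply: main => //; apply: ramsey_le rE.
  by rewrite prednK //; lia.
have rich_l : rich F m E [set l 0; l 1].
  move=> W /fl[l' [l'E l'K l'W]]; have [h'E h'l] := l_copy _ _ _ l'E.
  exists (l' \o ind), (pos 0), (pos 1); split=> //; first by rewrite !h'l !l'K.
  move=> s /indK <-; rewrite h'l => s0 s1; apply: l'W.
  apply/negP => /Kle; rewrite leq_eqVlt ltnS leqn0 => /orP[]/eqP si.
    by case/eqP: s1; apply/posP; rewrite si modn_small //; lia.
  by case/eqP: s0; apply/posP; rewrite si mod0n.
exists [set l 0; l 1] => //.
(* Richness against the empty set yields a copy through this pair, which therefore lies in [E]. *)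
have [h [u [v [[_ hE] uv <- _]]]] := rich_l set0 (leq_trans (eq_leq (cards0 _)) (leq0n _)).
exact: hE.
Qed.

(** * Symmetry of cycles and balanced multipartite graphs *)

(** By finiteness, injective edge-preserving self-maps of the vertex set are automorphisms. *)
Definition automorphism (S : finType) (F : graph S) (f : S -> S) :=
  [/\ {homo f : s / s \in vertices F}, {in vertices F &, injective f}
    & forall a b, adj F a b -> adj F (f a) (f b)].

Definition arc_transitive (S : finType) (F : graph S) :=
  forall u v u' v', adj F u v -> adj F u' v' ->
  exists f, [/\ automorphism F f, f u = u' & f v = v'].

(** Minimum degree 2, phrased as a neighbour of [u] avoiding a prescribed [v]. *)
Definition two_neighbours (S : finType) (F : graph S) :=
  forall u v, u \in vertices F -> exists2 w, w != v & adj F u w.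

Lemma cycle_arc_transitive (S : finType) (F : graph S) :
  is_cycle F -> arc_transitive F.
Proof.
move=> /cycle_positions[n [pos [ind [n3 posP posV indK adjE]]]].
have n0 : 0 < n by lia.
have ind_pos i : ind (pos i) = i %[mod n] by apply/posP; rewrite indK.
have autP (f : nat -> nat) : (forall i j, f i = f j %[mod n] <-> i = j %[mod n]) ->
    (forall i, f i.+1 = (f i).+1 %[mod n] \/ f i = (f i.+1).+1 %[mod n]) ->
    automorphism F (pos \o f \o ind) /\ forall i, (pos \o f \o ind) (pos i) = pos (f i).
  move=> fI fS; have fp i : (pos \o f \o ind) (pos i) = pos (f i) by apply/posP/fI.
  split=> //; split=> [s _|u v uV vV /= /posP /fI /posP|a b /adjE[i]].
  - exact: posV.
  - by rewrite !indK.
  - have : adj F (pos (f i)) (pos (f i.+1)).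
      by apply/adjE; case: (fS i) => /posP ->; [exists (f i); left|exists (f i.+1); right].
    by case=> fi [][-> ->]; rewrite !fp // adj_sym.
(* Arcs are [(a, a + e)], where [e = n.-1] stands for -1; equal [e] call for a rotation, different
   ones for a reflection. *)
have arcP u v : adj F u v -> exists a e, [/\ e = 1 \/ e = n.-1, u = pos a & v = pos (a + e)].
  move=> /adjE[i [][ui vi]]; first by exists i, 1; rewrite addn1; split=> //; left.
  exists i.+1, n.-1; split=> //; first by right.
  by rewrite ui; apply/posP; rewrite (_ : i.+1 + n.-1 = i + n) ?modnDr //; lia.
move=> u v u' v' /arcP[a [e [eE -> ->]]] /arcP[a' [e' [e'E -> ->]]].
have [ee'|ee'] := eqVneq e e'.
  pose f := addn (a' + n.-1 * a).
  have [i j|i|fA fp] := autP f.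
  - by rewrite /f; split=> /eqP ij; apply/eqP; rewrite eqn_modDl in ij *.
  - by left; rewrite /f addnS.
  exists (pos \o f \o ind); split=> //; rewrite fp; apply/posP.
    rewrite /f (_ : _ + a = a * n + a'); last by nia.
    by rewrite modnMDl.
  rewrite /f (_ : _ + (a + e) = a * n + (a' + e')); last by rewrite -ee'; nia.
  by rewrite modnMDl.
have [i j|i|fA fp] := autP (reflect_at n (a' + a)).
- exact: reflect_at_mod.
- right; rewrite /reflect_at (_ : (_ + n.-1 * i.+1).+1 = n + (a' + a + n.-1 * i)); last by lia.
  by rewrite modnDl.
exists (pos \o reflect_at n (a' + a) \o ind); split=> //; rewrite fp; apply/posP.
  rewrite /reflect_at (_ : a' + a + _ = a * n + a'); last by nia.
  by rewrite modnMDl.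
have [[e1 e'1]|[e1 e'1]] : (e = 1 /\ e' = n.-1) \/ (e = n.-1 /\ e' = 1) by lia.
  rewrite e1 e'1 /reflect_at (_ : a' + a + _ = a * n + (a' + n.-1)); last by nia.
  by rewrite modnMDl.
rewrite e1 e'1 /reflect_at (_ : a' + a + _ = (a + n.-2) * n + (a' + 1)); last by nia.
by rewrite modnMDl.
Qed.

Lemma cycle_two_neighbours (S : finType) (F : graph S) :
  is_cycle F -> two_neighbours F.
Proof.
move=> /cycle_positions[n [pos [ind [n3 posP posV indK adjE]]]] u v uV.
have adj1 : adj F u (pos (ind u).+1).
  by apply/adjE; exists (ind u); left; rewrite indK.
have adj2 : adj F u (pos (ind u + n.-1)).
  apply/adjE; exists (ind u + n.-1); right; split=> //.
  rewrite -{1}(indK _ uV); apply/posP.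
  by rewrite (_ : (_ + n.-1).+1 = ind u + n) ?modnDr //; lia.
have [v1|] := eqVneq (pos (ind u).+1) v; last by exists (pos (ind u).+1).
exists (pos (ind u + n.-1)) => //; rewrite -v1; apply/eqP => /posP /eqP.
by rewrite -addn1 eqn_modDl !modn_small; lia.
Qed.

(** If [v] is the only neighbour of [u], its class is a singleton; by balance all classes are, so
    [F] is complete on [u], [v] and has one edge. *)
Lemma multipartite_two_neighbours (S : finType) (F : graph S) :
  is_balanced_complete_multipartite F -> 2 <= #|edges F| -> two_neighbours F.
Proof.
move=> [P [partP PP FE]] F2 u v uV.
have adjE := complete_multipartite_adj FE.
have [covP trivP _] := and3P partP.
have inP x : x \in vertices F -> (pblock P x \in P) * (x \in pblock P x).
  by move=> xV; rewrite pblock_mem ?mem_pblock (eqP covP).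
have nbr : exists w, adj F u w.
  have /card_gt0P[e eF] : 0 < #|edges F| by apply: ltnW.
  move: (eF); rewrite FE => /imset2P[a b aV]; rewrite inE => /andP[bV ab] _.
  have [ua|ua] := eqVneq (pblock P u) (pblock P a); last by exists a; rewrite adjE uV aV.
  by exists b; rewrite adjE uV bV ua.
apply: NNPP => noW.
have only w : adj F u w -> w = v.
  by move=> uw; apply/eqP/negPn/negP => wv; apply: noW; exists w.
have uv : adj F u v by case: nbr => w uw; rewrite -(only w uw).
move: (uv); rewrite adjE => /and3P[_ vV buv].
have Bv : pblock P v = [set v].
  apply/setP => w; rewrite in_set1; apply/idP/eqP => [wB|->]; last exact: (inP v vV).2.
  have BV := (inP v vV).1.
  apply: only; rewrite adjE uV (def_pblock trivP BV wB) buv andbT /=.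
  by rewrite -(eqP covP); apply/bigcupP; exists (pblock P v).
have small w : w \in vertices F -> #|pblock P w| = 1.
  by move=> wV; rewrite (PP _ _ (inP w wV).1 (inP v vV).1) Bv cards1.
have V2 w : w \in vertices F -> (w == u) || (w == v).
  move=> wV; apply/norP => -[wu wv]; case/eqP: wv; apply: only.
  rewrite adjE uV wV /=; apply: contra wu => /eqP buw.
  have /eqP/cards1P[x Bx] := small _ uV.
  have := (inP u uV).2; have := (inP w wV).2; rewrite -buw Bx !inE => /eqP-> /eqP->.
  by [].
have: edges F \subset [set [set u; v]].
  apply/subsetP => e; rewrite FE => /imset2P[a b aV]; rewrite !inE => /andP[bV ab] ->.
  move: ab; have /orP[/eqP->|/eqP->] := V2 a aV; have /orP[/eqP->|/eqP->] := V2 b bV;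
  by rewrite ?eqxx // setUC.
by move/subset_leq_card; rewrite cards1 => F1; have := leq_trans F2 F1.
Qed.

Lemma pblock_tperm (S : finType) (P : {set {set S}}) (a b x : S) :
  pblock P a = pblock P b -> pblock P (tperm a b x) = pblock P x.
Proof. by move=> ab; case: tpermP => [->|->|]. Qed.

(** A permutation of the classes lifts to the vertices because class sizes are equal; transpositions
    inside the classes of [u'] and [v'] then correct the images of [u] and [v]. *)
Lemma multipartite_arc_transitive (S : finType) (F : graph S) :
  is_balanced_complete_multipartite F -> arc_transitive F.
Proof.
move=> [P [partP PP FE]].
have adjE := complete_multipartite_adj FE.
have [/eqP covP trivP _] := and3P partP.
have BP x : x \in vertices F -> pblock P x \in P by rewrite -covP => /pblock_mem.
have inB x : x \in vertices F -> x \in pblock P x by rewrite -covP mem_pblock.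
move=> u v u' v'; rewrite !adjE => /and3P[uV vV buv] /and3P[u'V v'V bu'v'].
(* The second transposition takes the class of [v] from wherever the first has put it, and fixes the
   class of [u']. *)
pose p := (tperm (pblock P u) (pblock P u') *
  tperm (tperm (pblock P u) (pblock P u') (pblock P v)) (pblock P v'))%g.
have pu : p (pblock P u) = pblock P u'.
  rewrite permM tpermL tpermD //; last by rewrite eq_sym.
  by rewrite -{2}(tpermL (pblock P u) (pblock P u')) (inj_eq perm_inj) eq_sym.
have pv : p (pblock P v) = pblock P v' by rewrite permM tpermL.
have pP B : B \in P -> p B \in P.
  move=> BinP; rewrite permM.
  have tP A C D : A \in P -> C \in P -> D \in P -> tperm A C D \in P.
    by move=> ? ? ?; case: tpermP => // ->.
  by rewrite !tP ?BP.
(* Classes are matched in the order of [enum]; on vertices the default [x] is never reached. *)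
pose f0 x := nth x (enum (p (pblock P x))) (index x (enum (pblock P x))).
have idx x : x \in vertices F -> index x (enum (pblock P x)) < size (enum (p (pblock P x))).
  move=> xV; rewrite -cardE (PP _ (pblock P x)) ?pP ?BP // cardE index_mem mem_enum.
  exact: inB.
have f0B x : x \in vertices F -> f0 x \in p (pblock P x).
  by move=> xV; rewrite -mem_enum mem_nth ?idx.
have f0p x : x \in vertices F -> pblock P (f0 x) = p (pblock P x).
  by move=> xV; apply: def_pblock (f0B x xV); rewrite ?pP ?BP.
have f0V x : x \in vertices F -> f0 x \in vertices F.
  move=> xV; rewrite -covP; apply/bigcupP; exists (p (pblock P x)); first by rewrite pP ?BP.
  exact: f0B.
have f0I : {in vertices F &, injective f0}.
  move=> x y xV yV fxy; have bxy : pblock P x = pblock P y.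
    by apply: (@perm_inj _ p); rewrite -!f0p // fxy.
  have yE : y \in enum (pblock P y) by rewrite mem_enum inB.
  have xE : x \in enum (pblock P y) by rewrite mem_enum -bxy inB.
  have ix : index x (enum (pblock P y)) < size (enum (p (pblock P y))).
    by rewrite -bxy idx.
  move: fxy; rewrite /f0 bxy (set_nth_default y) // => /eqP.
  rewrite nth_uniq ?enum_uniq ?idx // => /eqP ixy.
  by rewrite -(nth_index y xE) ixy nth_index.
pose f x := tperm (f0 v) v' (tperm (f0 u) u' (f0 x)).
have bu : pblock P (f0 u) = pblock P u' by rewrite f0p // pu.
have bv : pblock P (f0 v) = pblock P v' by rewrite f0p // pv.
have fp x : x \in vertices F -> pblock P (f x) = p (pblock P x).
  by move=> xV; rewrite !pblock_tperm // f0p.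
have neqB x y : pblock P x != pblock P y -> x != y by apply: contraNneq => ->.
have tV a b x : a \in vertices F -> b \in vertices F -> x \in vertices F ->
    tperm a b x \in vertices F.
  by move=> ? ? ?; case: tpermP => // ->.
have fV x : x \in vertices F -> f x \in vertices F.
  by move=> xV; rewrite !tV ?f0V.
exists f; split.
- split=> // [x y xV yV /perm_inj/perm_inj/f0I-> //|a b].
  rewrite !adjE => /and3P[aV bV ab]; rewrite !fV // !fp //.
  by rewrite (inj_eq perm_inj).
- by rewrite /f tpermL tpermD // neqB // ?bv eq_sym.
- by rewrite /f (tpermD (x := f0 u)) ?tpermL // neqB // bv ?bu.
Qed.

(** * Embedding a forest of copies *)

(** The bijection of subtypes becomes two total maps; [t0] and its preimage serve as defaults. *)
Lemma isomorphic_maps (S T : finType) (H : graph S) (F : graph T) (t0 : T) :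
  t0 \in vertices F -> isomorphic H F ->
  exists (f : S -> T) (g : T -> S),
    [/\ {homo f : s / s \in vertices H >-> s \in vertices F},
        {homo g : t / t \in vertices F >-> t \in vertices H},
        {in vertices H, cancel f g}, {in vertices F, cancel g f}
      & {in vertices H &, forall x y, adj H x y = adj F (f x) (f y)}].
Proof.
move=> t0F [p [[q pK qK] pE]].
pose s0 := q (exist _ t0 t0F).
pose f s := val (p (insubd s0 s)).
pose g t := val (q (insubd (p s0) t)).
have fE s : f (val s) = val (p s) by rewrite /f valKd.
have gE t : g (val t) = val (q t) by rewrite /g valKd.
have inH s : s \in vertices H -> exists s' : {x | x \in vertices H}, s = val s' :> S.
  by move=> sH; exists (exist _ s sH).
have inF t : t \in vertices F -> exists t' : {y | y \in vertices F}, t = val t' :> T.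
  by move=> tF; exists (exist _ t tF).
exists f, g; split.
- by move=> s _; apply: valP.
- by move=> t _; apply: valP.
- by move=> s /inH[s' ->]; rewrite fE gE pK.
- by move=> t /inF[t' ->]; rewrite gE fE qK.
- by move=> x y /inH[x' ->] /inH[y' ->]; rewrite !fE /adj pE.
Qed.

Lemma arrows_ramsey (S T : finType) (F : graph S) (G : graph T) r (a : S) :
  a \in vertices F -> arrows_nni G F r -> ramsey F (edges G) r.
Proof.
move=> aF GF c; have [H [[_ /subsetP HG] HF [k kP]]] := GF (fun e => c (val e)).
have [f [g [fV gV fK gK fE]]] := isomorphic_maps aF HF.
have gH u v : adj F u v -> [set g u; g v] \in edges H.
  move=> uv; have [_ uV vV] := adjP uv.
  by have := fE _ _ (gV _ uV) (gV _ vV); rewrite !gK // uv.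
exists g; split.
  by split=> [|u v /gH/HG //]; apply: can_in_inj gK.
by exists k => u v /gH uvH; apply: (kP (exist (fun e => e \in edges G) _ (HG _ uvH)) uvH).
Qed.

(** Richness does not say which arc of the copy lies over [x], [y]; an automorphism takes [u], [v]
    there. *)
Lemma attach_at_edge (S U : finType) (F : graph S) m (E : {set {set U}})
    (W : {set U}) x y u v :
  arc_transitive F -> rich F m E [set x; y] -> adj F u v -> #|W| <= m ->
  exists h, [/\ copy F E h, h u = x, h v = y
    & forall s, s \in vertices F -> s != u -> s != v -> h s \notin W].
Proof.
move=> FA xyR uv /xyR[h0 [a [b [[hI hE] ab habxy hW]]]].
have [a' [b' [a'b' hab' h'W]]] : exists a' b', [/\ adj F a' b', h0 a' = x /\ h0 b' = y
    & forall s, s \in vertices F -> s != a' -> s != b' -> h0 s \notin W].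
  case: (set2_eq habxy) => -[ha hb]; first by exists a, b.
  by exists b, a; rewrite adj_sym; split=> // s sV sb sa; apply: hW.
have [f [[fV fI fE] fu fv]] := FA _ _ _ _ uv a'b'.
have [_ uV vV] := adjP uv.
exists (h0 \o f); split=> /=; rewrite ?fu ?fv ?(hab'.1) ?(hab'.2) //.
  split=> [s t sV tV /= /hI eq_f|s t /fE /hE //].
  by apply: fI => //; apply: eq_f; apply: fV.
move=> s sV su sv; apply: h'W; first exact: fV.
  by rewrite -fu (inj_in_eq fI).
by rewrite -fv (inj_in_eq fI).
Qed.

(** A copy over [x], [y] sends a second neighbour [w] of [u] off [W]; the image of [uw] is rich in
    [E], and a copy attached there can meet [W] only in [x]. *)
Lemma attach_at_vertex (S U : finType) (F : graph S) m (E E1 : {set {set U}})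
    (W : {set U}) x y u :
  arc_transitive F -> two_neighbours F ->
  (forall e, e \in E1 -> rich F m E e) -> rich F m E1 [set x; y] ->
  u \in vertices F -> #|W| <= m ->
  exists h, [/\ copy F E h, h u = x & forall s, s \in vertices F -> s != u -> h s \notin W].
Proof.
move=> FA F2 E1E xyR uV Wm; have [v _ uv] := F2 u u uV.
have [h1 [[_ h1E] h1u h1v h1W]] := attach_at_edge FA xyR uv Wm.
have [w wv uw] := F2 u v uV; have [uNw _ wV] := adjP uw.
have := E1E _ (h1E _ _ uw); rewrite h1u => xwR.
have [h [hE hu hw hW]] := attach_at_edge FA xwR uw Wm.
exists h; split=> // s sV su; have [->|sw] := eqVneq s w; last exact: hW.
by rewrite hw h1W // eq_sym.
Qed.

(** A copy attached at a vertex contains an edge [ab] missing [u], whose image avoids [W]; the final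
    copy is attached to it. *)
Lemma attach_disjoint (S U : finType) (F : graph S) m (E E1 E2 : {set {set U}})
    (W : {set U}) x y u :
  arc_transitive F -> two_neighbours F ->
  (forall e, e \in E1 -> rich F m E e) -> (forall e, e \in E2 -> rich F m E1 e) ->
  rich F m E2 [set x; y] -> u \in vertices F -> #|W| <= m ->
  exists2 h, copy F E h & forall s, s \in vertices F -> h s \notin W.
Proof.
move=> FA F2 E1E E2E1 xyR uV Wm.
have [h1 [[_ h1E] _ h1W]] := attach_at_vertex FA F2 E2E1 xyR uV Wm.
have [a au ua] := F2 u u uV; have [_ _ aV] := adjP ua.
have [b bu ab] := F2 a u aV; have [_ _ bV] := adjP ab.
have [h [hE ha hb hW]] := attach_at_edge FA (E1E _ (h1E _ _ ab)) ab Wm.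
exists h => // s sV; have [->|sa] := eqVneq s a; first by rewrite ha h1W.
by have [->|sb] := eqVneq s b; [rewrite hb h1W | apply: hW].
Qed.

Lemma isomorphic_neighbour (S T : finType) (F : graph S) (H : graph T) a x :
  a \in vertices F -> two_neighbours F -> isomorphic H F -> x \in vertices H ->
  exists y, adj H x y.
Proof.
move=> aV F2 HF xH; have [f [g [fV gV fK gK fE]]] := isomorphic_maps aV HF.
have [w _ fxw] := F2 _ a (fV _ xH); have [_ _ wV] := adjP fxw.
by exists (g w); rewrite fE ?gV // gK.
Qed.

Lemma embed_forest (S T U : finType) (F : graph S) (FF : {set graph T})
    (E : {set {set U}}) (a : S) :
  arc_transitive F -> two_neighbours F -> a \in vertices F ->
  forest_of_copies_of F FF -> deep F #|T| (3 * #|FF|) E ->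
  exists g : T -> U, {in vertices (graph_union FF) &, injective g} /\
    forall x y, adj (graph_union FF) x y -> [set g x; g y] \in E.
Proof.
move=> FA F2 aV [[f [fI FFE fP]] isoF].
have fiso i : isomorphic (f i) F by apply: isoF; rewrite FFE imset_f.
pose V j := \bigcup_(i : 'I_#|FF| | i < j) vertices (f i).
suff H j (E' : {set {set U}}) : j <= #|FF| -> deep F #|T| (3 * j) E' ->
    exists g : T -> U, {in V j &, injective g} /\
      forall i : 'I_#|FF|, i < j -> forall x y, adj (f i) x y -> [set g x; g y] \in E'.
  move=> /(H _ _ (leqnn _))[g [gI gE]]; exists g; split.
    suff -> : vertices (graph_union FF) = V #|FF| by [].
    apply/setP => x; apply/bigcupP/bigcupP => [[G]|[i _ xi]].
      by rewrite {1}FFE => /imsetP[i _ ->]; exists i.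
    by exists (f i) => //; rewrite FFE imset_f.
  move=> x y /bigcupP[G]; rewrite {1}FFE => /imsetP[i _ ->]; exact: gE.
elim: j E' => [|j IHj] E' jF.
  (* [V 0] is empty; [h a] only supplies some element of [U]. *)
  move=> /deep_copy[h _]; exists (fun=> h a); split=> // x y.
  by case/bigcupP.
(* The earlier copies go into [E3]; the three levels above it are what a disjoint attachment uses
   up. *)
rewrite mulnS => -[E1 [E1E' rE1 [E2 [E2E1 rE2 [E3 [E3E2 rE3 dE3]]]]]].
have [g [gI gE]] := IHj _ (ltnW jF) dE3.
have [h3 h3E3] := deep_copy dE3.
have E3E1 := subset_trans E3E2 E2E1.
have E3E' := subset_trans E3E1 E1E'.
pose jo := Ordinal jF; pose A := vertices (f jo) :&: V j.
have [p [p' [pV p'V pK p'K pE]]] := isomorphic_maps aV (fiso jo).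
pose W := g @: V j.
have Wm : #|W| <= #|T| by rewrite (leq_trans (leq_imset_card _ _)) ?max_card.
have pI : {in vertices (f jo) &, injective p} := can_in_inj pK.
(* Agreement on [A] lets [g] and [h] be glued; avoiding [W] makes the result injective. *)
suff [h [[hI hE] hA hW]] : exists h, [/\ copy F E' h, {in A, forall t, h (p t) = g t}
    & {in vertices (f jo) :\: V j, forall t, h (p t) \notin W}].
  pose g' t := if t \in V j then g t else h (p t).
  have g'V t : t \in vertices (f jo) -> g' t = h (p t).
    by rewrite /g' => tV; case: ifP => // tj; rewrite hA // inE tV.
  have VS t : t \in V j.+1 -> t \in V j \/ t \in vertices (f jo) :\: V j.
    case/bigcupP=> i; rewrite ltnS leq_eqVlt => /predU1P[ij|ij] ti.
      have -> : jo = i by apply: val_inj.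
      by case tV: (t \in V j); [left | right; rewrite inE tV].
    by left; apply/bigcupP; exists i.
  exists g'; split.
    have cross x y : x \in V j -> y \in vertices (f jo) :\: V j -> g' x <> g' y.
      move=> xV yV; have := hW _ yV; move: yV; rewrite inE => /andP[yV yf].
      rewrite /g' xV (negPf yV) => /negP hyW gxy; apply: hyW; rewrite -gxy.
      exact: imset_f.
    move=> x y /VS[xV|xV] /VS[yV|yV].
    - by rewrite /g' xV yV; apply: gI.
    - by move/(cross _ _ xV yV).
    - by move/esym/(cross _ _ yV xV).
    - move: xV yV; rewrite !inE => /andP[xV xf] /andP[yV yf].
      rewrite !g'V // => hxy; apply: pI => //.
      by apply: hI => //; apply: pV.
  move=> i; rewrite ltnS leq_eqVlt => /predU1P[ij|ij] x y xy.
    have {ij} ij : i = jo by apply: val_inj.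
    rewrite ij in xy; have [_ xV yV] := adjP xy.
    by rewrite !g'V // hE // -pE.
  have [_ xV yV] := adjP xy.
  have inV t : t \in vertices (f i) -> t \in V j by move=> tV; apply/bigcupP; exists i.
  rewrite /g' !inV //; apply: (subsetP E3E'); exact: gE xy.
have hAP t : t \in A -> t \in vertices (f jo) /\ t \in V j by rewrite inE => /andP[].
have : [\/ A = set0, exists x, A = [set x]
    | A \in edges (f jo) /\ A \in \bigcup_(i : 'I_#|FF| | i < j) edges (f i)].
  have [j0|j0] := posnP j; last exact: (fP jo).
  apply: Or31; rewrite /A /V j0 big_pred0 ?setI0 //.
(* The edge to start from lies in any copy in [E3], in an earlier copy at [x], or is the shared edge
   itself. *)
case=> [A0|[x Ax]|[Af AE]].
- have [b _ ab] := F2 a a aV.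
  have [h hE hW] := attach_disjoint FA F2 rE1 rE2 (rE3 _ (h3E3.2 _ _ ab)) aV Wm.
  exists h; split=> // t; first by rewrite A0 inE.
  by rewrite inE => /andP[_ /pV]; apply: hW.
- have /hAP[xf xV] : x \in A by rewrite Ax inE.
  have /bigcupP[i ij xi] := xV.
  have [y xy] := isomorphic_neighbour aV F2 (fiso i) xi.
  have xyE2 := subsetP E3E2 _ (gE _ ij _ _ xy).
  have [h [hE hx hW]] := attach_at_vertex FA F2 rE1 (rE2 _ xyE2) (pV _ xf) Wm.
  exists h; split=> // t; first by rewrite Ax inE => /eqP->.
  rewrite inE => /andP[tV tf]; apply: hW; first exact: pV.
  by rewrite (inj_in_eq pI) //; apply: contraNneq tV => ->.
have /andP[_ /cards2P[x [y [xy Axy]]]] := edgesP Af.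
have /hAP[xf xV] : x \in A by rewrite Axy !inE eqxx.
have /hAP[yf yV] : y \in A by rewrite Axy !inE eqxx orbT.
have /bigcupP[i ij] := AE; rewrite Axy => xyi.
have xyE1 := subsetP E3E1 _ (gE _ ij _ _ xyi).
have pxy : adj F (p x) (p y) by rewrite -pE // /adj -Axy.
have [h [hE hx hy hW]] := attach_at_edge FA (rE1 _ xyE1) pxy Wm.
exists h; split=> // t; first by move=> /set2P[]->.
rewrite inE => /andP[tV tf]; apply: hW; first exact: pV.
  by rewrite (inj_in_eq pI) //; apply: contraNneq tV => ->.
by rewrite (inj_in_eq pI) //; apply: contraNneq tV => ->.
Qed.

(** An image vertex belongs to [G] because an edge of [Q] passes through its preimage. *)
Lemma embedded_subgraph (T U : finType) (Q : graph T) (G : graph U) (g : T -> U) :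
  (forall x, x \in vertices Q -> exists y, adj Q x y) ->
  {in vertices Q &, injective g} ->
  (forall x y, adj Q x y -> [set g x; g y] \in edges G) ->
  has_subgraph_isomorphic_to G Q.
Proof.
move=> Qnbr gI gE.
have edgeE e : e \in edges Q -> exists x y, [/\ e = [set x; y], adj Q x y & x != y].
  move=> eQ; have /andP[_ /cards2P[x [y [xy eE]]]] := edgesP eQ.
  by exists x, y; rewrite /adj -eE.
have Hax : graph_axiom (g @: vertices Q, (fun e : {set T} => g @: e) @: edges Q).
  apply/forall_inP => _ /imsetP[e eQ ->] /=; have /andP[eV e2] := edgesP eQ.
  rewrite imsetS //= card_in_imset // => x y /(subsetP eV) xV /(subsetP eV) yV.
  exact: gI.
pose H := Graph Hax; exists H; split.
  split; apply/subsetP => z /imsetP[x xQ ->].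
    have [y xy] := Qnbr _ xQ.
    have /andP[/subsetP GV _] := edgesP (gE _ _ xy).
    by apply: GV; rewrite !inE eqxx.
  have [u [v [-> uv _]]] := edgeE _ xQ.
  by rewrite imsetU !imset_set1; apply: gE.
have gV (y : {y | y \in vertices Q}) : g (val y) \in vertices H by apply/imset_f/valP.
pose k (y : {y | y \in vertices Q}) : {x | x \in vertices H} :=
  exist (fun x => x \in vertices H) _ (gV y).
have kI : injective k.
  by move=> x y /(congr1 val) /= /(gI _ _ (valP x) (valP y)) /val_inj.
have kS x : exists y, k y = x.
  have /imsetP[t tQ xt] := valP x.
  by exists (exist (fun y => y \in vertices Q) t tQ); apply: val_inj; rewrite /= xt.
have [k' k'K] := fin_all_exists kS.
exists k'; split; first by exists k => // x; apply: kI; rewrite k'K.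
move=> x y; rewrite -{1}(k'K x) -{1}(k'K y) /=.
move: (k' x) (k' y) => s t; apply/imsetP/idP => [[e eQ]|stQ].
  have [u [v [eE uv _]]] := edgeE _ eQ; have [_ uV vV] := adjP uv.
  rewrite eE imsetU !imset_set1 => /set2_eq.
  have valI z (zV : z \in vertices Q) (w : {y | y \in vertices Q}) :
    g (val w) = g z -> val w = z by move/(gI _ _ (valP w) zV).
  by case=> -[/valI -> // /valI -> //]; rewrite // setUC.
by exists [set val s; val t] => //; rewrite imsetU !imset_set1.
Qed.

Theorem theorem1p5 (S : finType) (F : graph S)
    (hF : is_cycle F \/
          (is_balanced_complete_multipartite F /\ 2 <= #|edges F|))
    (T : finType) (FF : {set graph T}) (hFF : forest_of_copies_of F FF) :
  exists r : nat, 2 <= r /\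
    forall (U : finType) (G : graph U),
      arrows_nni G F r -> has_subgraph_isomorphic_to G (graph_union FF).
Proof.
(* [#|T|] bounds the number of vertices that a partial embedding occupies. *)
have [FA F2 FR [a aV]] : [/\ arc_transitive F, two_neighbours F, forces_rich F #|T|
    & exists a, a \in vertices F].
  case: hF => [Fcyc|[Fmul FE]].
    split; [exact: cycle_arc_transitive | exact: cycle_two_neighbours
      | exact: cycle_forces_rich |].
    by have [n [pos [_ [_ _ posV _ _]]]] := cycle_positions Fcyc; exists (pos 0).
  split; [exact: multipartite_arc_transitive | exact: multipartite_two_neighbours
    | by apply: multipartite_forces_rich => //; apply: ltnW |].
  have /card_gt0P[e /edgesP/andP[/subsetP eV /eqP e2]] : 0 < #|edges F| by apply: ltnW.
  have /card_gt0P[a /eV aV] : 0 < #|e| by rewrite e2.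
  by exists a.
have [b _ ab] := F2 a a aV.
have [r rP] := ramsey_deep ab FR (3 * #|FF|).
(* [r.+2] instead of [r.+1] ensures at least two colours. *)
exists r.+2; split=> // U G /(arrows_ramsey aV) /(ramsey_le (leqnSn _)) /rP dE.
have [g [gI gE]] := embed_forest FA F2 aV hFF dE.
apply: embedded_subgraph gI gE => x /bigcupP[H HFF xH].
have [y xy] := isomorphic_neighbour aV F2 (hFF.2 H HFF) xH.
by exists y; apply/bigcupP; exists H.
Qed.
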